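(* Let $X$ be a geodesic metric space, let $\omega$ be any ultrafilter, let $(d_n)$ be a sequence of positive numbers such that $\lim_\omega d_n=\infty$, and let $(o_n)$ be a sequence of points in $X$. The following conditions are equivalent: (i) The asymptotic cone $\mathrm{Con}^\omega(X,(o_n),(d_n))$ has a cut-point. (ii) There exists a sequence of pairs of points $(a_n,b_n)$ in $X$ with $\mathrm{dist}(a_n,b_n)=O_\omega(d_n)$ and with $\frac{\mathrm{dist}(a_n,o_n)}{d_n}$, $\frac{\mathrm{dist}(b_n,o_n)}{d_n}$ bounded, and a sequence of midpoints $c_n$ of geodesics $[a_n,b_n]$, such that the sequence $\mathrm{div}_\gamma(a_n,b_n,c_n;\delta)$, $n\ge1$, is superlinear $\omega$-almost surely for every $\delta\in(0,1)$ and $\gamma\ge0$, that is, $\lim_\omega\frac{\mathrm{div}_\gamma(a_n,b_n,c_n;\delta)}{d_n}=\infty$. Moreover, if condition (ii) holds, then the point $C=(c_n)^\omega$ is a cut-point in $\mathrm{Con}^\omega(X,(o_n),(d_n))$ separating $A=(a_n)^\omega$ from $B=(b_n)^\omega$.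
   Context: Ultrafilters are non-principal ultrafilters on $\mathbb N$; a property holds $\omega$-almost surely if the set of $n$ for which it holds belongs to $\omega$. For sequences $(d_n),(d_n')$, $d_n'=O_\omega(d_n)$ means that for some constant $K>1$, $\frac1K d_n'<d_n<Kd_n'$ $\omega$-almost surely. $\mathrm{Con}^\omega(X,(o_n),(d_n))$ is the quotient of the set of sequences $(x_n)$ in $X$ with $\lim_\omega\mathrm{dist}(x_n,o_n)/d_n<\infty$ by the relation $\lim_\omega\mathrm{dist}(x_n,y_n)/d_n=0$, with metric $\lim_\omega\mathrm{dist}(x_n,y_n)/d_n$; the class of $(x_n)$ is denoted $(x_n)^\omega$. A cut-point is a point $C$ whose removal disconnects the space; it separates $A$ from $B$ if $A,B$ lie in different connected components of the complement of $C$. For $0<\delta<1$, $\gamma\ge0$ and $a,b,c\in X$ with $r=\min(\mathrm{dist}(c,a),\mathrm{dist}(c,b))>0$, $\mathrm{div}_\gamma(a,b,c;\delta)$ is the infimum of the lengths of paths connecting $a,b$ and avoiding the ball $B(c,\delta r-\gamma)$ (a ball of non-positive radius is empty); it is $\infty$ if no such path exists. *)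

(* Defs.v *)
From HB Require Import structures.
From mathcomp Require Import all_boot all_order all_algebra generic_quotient.
From mathcomp Require Import all_classical all_reals all_analysis.

Set Implicit Arguments.
Unset Strict Implicit.
Unset Printing Implicit Defensive.

Import Order.TTheory GRing.Theory Num.Theory.
Import numFieldNormedType.Exports.

Local Open Scope classical_set_scope.
Local Open Scope ring_scope.

Definition nonprincipal (omega : set_system nat) :=
  forall n, omega <> principal_filter n.

(* [u = O_omega(v)] is two-sided. *)
Definition bigO_omega (R : realType) (omega : set_system nat) (u v : nat -> R) :=
  exists2 K : R, 1 < K & \forall n \near omega, K^-1 * u n < v n < K * u n.

Section MetricGeometry.
Context (R : realType) (X : metricType R).

Definition geodesic (a b : X) (g : R -> X) :=
  [/\ g 0 = a, g (mdist a b) = b &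
      {in `[0, mdist a b] &, forall s t, mdist (g s) (g t) = `|s - t|}].

Definition geodesic_space := forall a b : X, exists g, geodesic a b g.

Definition geodesic_midpoint (a b c : X) :=
  exists2 g, geodesic a b g & c = g (mdist a b / 2).

Definition path_between (a b : X) (p : R -> X) :=
  [/\ {within `[0, 1]%classic, continuous p}, p 0 = a & p 1 = b].

(* The sequence [s] lists the points of a partition of [0, 1], except 0. *)
Definition path_length (p : R -> X) : \bar R :=
  ereal_sup [set (\sum_(i < size s)
    mdist (p (nth 0 (0 :: s) i)) (p (nth 0 (0 :: s) i.+1)))%:E
    | s in itv_partition 0 1].

(* [ball] is the open ball, hence empty when the radius is nonpositive. The
   infimum of the empty set is +oo. The value is only meaningful when
   [min (dist c a) (dist c b)] is positive. *)
Definition divergence (gamma : R) (a b c : X) (delta : R) : \bar R :=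
  let r := Num.min (mdist c a) (mdist c b) in
  ereal_inf [set path_length p | p in [set p | path_between a b p /\
    forall t : R, t \in `[0, 1] -> ~ ball c (delta * r - gamma) (p t)]].

Definition cut_point (C : X) := ~ connected (~` [set C]).

Definition separates (C A B : X) :=
  [/\ A <> C, B <> C & ~ connected_component (~` [set C]) A B].

End MetricGeometry.

Section UltraLimits.
Context (R : realType) (omega : set_system nat) (omegaU : UltraFilter omega).
Implicit Types u v : nat -> R.

Lemma ultra_fmap (T : Type) (f : nat -> T) : UltraFilter (f @ omega).
Proof.
split; first exact: fmap_proper_filter.
move=> G PG sG; apply/seteqP; split=> // A GA.
have [//|nA] := in_ultra_setVsetC (f @^-1` A) omegaU.
have /(filterI GA) : G (~` A) by exact: sG.
by rewrite setICr => /filter_not_empty.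
Qed.

Lemma ultra_bounded_cvg u (M : R) :
  (\forall n \near omega, 0 <= u n <= M) -> cvg (u @ omega).
Proof.
move=> uM; have cK := @segment_compact R 0 M.
move: cK; rewrite compact_ultra => /(_ (u @ omega) (ultra_fmap u)).
case=> [|l [_ ul]]; last by apply/cvg_ex; exists l.
by rewrite nbhs_filterE; apply: filterS uM => n; rewrite /= in_itv.
Qed.

Lemma cvg_ultra_bounded u : cvg (u @ omega) ->
  exists M, \forall n \near omega, u n <= M.
Proof.
move=> /cvgrPdist_lt /(_ 1 ltr01) cu; exists (lim (u @ omega) + 1).
apply: filterS cu => n; rewrite distrC ltr_norml => /andP[_].
by rewrite ltrBlDl => /ltW.
Qed.

End UltraLimits.

(* [Con omegaU o d_gt0] is the asymptotic cone Con^omega(X, (o_n), (d_n)). *)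
Section AsymptoticCone.
Context (R : realType) (X : metricType R) (omega : set_system nat).
Context (omegaU : UltraFilter omega) (o : nat -> X) (d : nat -> R).
Context (d_gt0 : forall n, 0 < d n).
Implicit Types x y z : nat -> X.

Definition scaled_dist x y (n : nat) : R := mdist (x n) (y n) / d n.

(* Existence of the limit in [R] is finiteness of the omega-limit, since every
   sequence has an omega-limit in the extended real line. *)
Definition in_cone x := cvg (scaled_dist x o @ omega).

Record cone_seq := ConeSeq { cone_fun :> nat -> X; _ : in_cone cone_fun }.

HB.instance Definition _ := gen_eqMixin cone_seq.
HB.instance Definition _ := gen_choiceMixin cone_seq.

Definition omega_dist x y : R := lim (scaled_dist x y @ omega).

Lemma scaled_dist_ge0 x y n : 0 <= scaled_dist x y n.
Proof. by rewrite divr_ge0 ?mdist_ge0// ltW. Qed.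

Lemma scaled_dist_sym x y : scaled_dist x y = scaled_dist y x.
Proof. by apply/funext => n; rewrite /scaled_dist metric_sym. Qed.

Lemma scaled_dist_triangle y x z n :
  scaled_dist x z n <= scaled_dist x y n + scaled_dist y z n.
Proof. by rewrite -mulrDl ler_pM2r ?invr_gt0// metric_triangle. Qed.

Lemma in_cone_bounded x (M : R) :
  (\forall n \near omega, scaled_dist x o n <= M) -> in_cone x.
Proof.
move=> xM; apply: (ultra_bounded_cvg (M := M) omegaU).
by apply: filterS xM => n ->; rewrite scaled_dist_ge0.
Qed.

Lemma cvg_scaled_dist (x y : cone_seq) : cvg (scaled_dist x y @ omega).
Proof.
have bdd (z : cone_seq) : in_cone z by case: z.
have [M xM] := cvg_ultra_bounded omegaU (bdd x).
have [N yN] := cvg_ultra_bounded omegaU (bdd y).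
apply: (ultra_bounded_cvg (M := M + N) omegaU).
apply: filterS2 xM yN => n xM yN; rewrite scaled_dist_ge0/=.
apply: le_trans (scaled_dist_triangle o _ _ _) _.
by rewrite (scaled_dist_sym o) lerD.
Qed.

Lemma omega_dist_ge0 (x y : cone_seq) : 0 <= omega_dist x y.
Proof.
apply: limr_ge; first exact: cvg_scaled_dist.
by apply: nearW => n; exact: scaled_dist_ge0.
Qed.

Lemma omega_distxx x : omega_dist x x = 0.
Proof.
rewrite /omega_dist (_ : scaled_dist x x = cst 0).
  by apply: cvg_lim => //; exact: cvg_cst.
by apply/funext => n; rewrite /scaled_dist mdistxx mul0r.
Qed.

Lemma omega_dist_sym x y : omega_dist x y = omega_dist y x.
Proof. by rewrite /omega_dist scaled_dist_sym. Qed.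

Lemma omega_dist_triangle (y x z : cone_seq) :
  omega_dist x z <= omega_dist x y + omega_dist y z.
Proof.
rewrite /omega_dist -limD; [|exact: cvg_scaled_dist..].
apply: ler_lim; [exact: cvg_scaled_dist| |].
  by apply: is_cvgD; exact: cvg_scaled_dist.
by apply: nearW => n; exact: scaled_dist_triangle.
Qed.

Definition cone_eq (x y : cone_seq) := omega_dist x y == 0.

Lemma cone_eq_refl : reflexive cone_eq.
Proof. by move=> x; rewrite /cone_eq omega_distxx. Qed.

Lemma cone_eq_sym : symmetric cone_eq.
Proof. by move=> x y; rewrite /cone_eq omega_dist_sym. Qed.

Lemma cone_eq_trans : transitive cone_eq.
Proof.
move=> y x z /eqP xy /eqP yz; rewrite /cone_eq eq_le omega_dist_ge0 andbT.
by rewrite (le_trans (omega_dist_triangle y _ _))// xy yz addr0.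
Qed.

Canonical cone_equiv := EquivRel cone_eq cone_eq_refl cone_eq_sym cone_eq_trans.

Definition Con := {eq_quot cone_equiv}%qT.

HB.instance Definition _ := Choice.on Con.

(* The class (x_n)^omega. *)
Definition cone_class x (hx : in_cone x) : Con := (\pi_Con (ConeSeq hx))%qT.

Definition cone_dist (A B : Con) : R := omega_dist (repr A) (repr B).

Lemma cone_distxx A : cone_dist A A = 0.
Proof. exact: omega_distxx. Qed.

Lemma cone_dist_eq0 A B : cone_dist A B = 0 -> A = B.
Proof.
move=> AB; rewrite -[A]reprK -[B]reprK; apply/eqmodP.
by rewrite /= /cone_eq; exact/eqP.
Qed.

Lemma cone_dist_sym A B : cone_dist A B = cone_dist B A.
Proof. exact: omega_dist_sym. Qed.

Lemma cone_dist_triangle B A C :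
  cone_dist A C <= cone_dist A B + cone_dist B C.
Proof. exact: omega_dist_triangle. Qed.

HB.instance Definition _ := @isMetric.Build R Con cone_dist
  cone_distxx cone_dist_eq0 cone_dist_sym cone_dist_triangle.

Lemma mdist_cone_class x y (hx : in_cone x) (hy : in_cone y) :
  mdist (cone_class hx) (cone_class hy) = lim (scaled_dist x y @ omega).
Proof.
have repr0 z (hz : in_cone z) :
    omega_dist (repr (cone_class hz)) (ConeSeq hz) = 0.
  by have /eqmodP/eqP := reprK (cone_class hz).
apply/eqP; rewrite -[_ == _]/(cone_dist _ _ == omega_dist (ConeSeq hx) (ConeSeq hy)).
rewrite eq_le; apply/andP; split.
  rewrite (le_trans (omega_dist_triangle (ConeSeq hx) _ _))// repr0 add0r.
  rewrite (le_trans (omega_dist_triangle (ConeSeq hy) _ _))//.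
  by rewrite (omega_dist_sym (ConeSeq hy)) repr0 addr0.
rewrite (le_trans (omega_dist_triangle (repr (cone_class hx)) _ _))//.
rewrite (omega_dist_sym (ConeSeq hx)) repr0 add0r.
by rewrite (le_trans (omega_dist_triangle (repr (cone_class hy)) _ _))// repr0 addr0.
Qed.

End AsymptoticCone.

Definition superlinear_divergence (R : realType) (X : metricType R)
    (omega : set_system nat) (o : nat -> X) (d : nat -> R)
    (a b c : nat -> X) :=
  [/\ bigO_omega omega (fun n => mdist (a n) (b n)) d,
      bounded_fun (fun n => mdist (a n) (o n) / d n : R^o),
      bounded_fun (fun n => mdist (b n) (o n) / d n : R^o),
      (forall n, geodesic_midpoint (a n) (b n) (c n)) &
      forall delta gamma : R, 0 < delta < 1 -> 0 <= gamma ->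
        (fun n => divergence gamma (a n) (b n) (c n) delta * (d n)^-1%:E)%E
          @ omega --> +oo%E].

(* Main.v *)
(* If the divergence is superlinear but A and B lie in the same component
   of the complement of C, then the set of points of the cone whose
   representatives are joined to a_n, omega-almost surely, by
   O(d_n)-Lipschitz paths at distance at least e * d_n from c_n is
   relatively clopen in that complement, because two points P and Q with
   dist(P, Q) < dist(P, C) are joined by geodesics far from c_n. Hence it
   contains B, which bounds the divergence linearly.

   Conversely, given a cut point C, points A and B in different components
   can be moved along geodesics towards C until they are equidistant from
   C. Every geodesic from A to B then passes through C, at its midpoint,
   so C is represented by midpoints of [a_n, b_n]. If the divergence were
   at most L * d_n omega-almost surely, subdividing almost optimal paths
   into a fixed number of short steps would yield in the cone a finite
   chain from A to B whose steps are smaller than their distance to C, and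
   A and B would be in the same component. *)
Require Import Defs.
From mathcomp Require Import all_boot all_order all_algebra.
From mathcomp Require Import all_classical all_reals all_analysis.
From mathcomp Require Import ring lra.

Set Implicit Arguments.
Unset Strict Implicit.
Unset Printing Implicit Defensive.

Import Order.TTheory GRing.Theory Num.Theory.
Import numFieldNormedType.Exports.

Local Open Scope classical_set_scope.
Local Open Scope ring_scope.

(** * Connected components, Lipschitz paths and path length *)

Section MetricPaths.
Context (R : realType) (M : metricType R).
Implicit Types (a b c x y z : M) (D : set M) (L t : R) (p g : R -> M).

Lemma ler_mdist_dist x y z : `|mdist x y - mdist x z| <= mdist y z.
Proof.
have xyz := metric_triangle x z y; have xzy := metric_triangle x y z.
rewrite (metric_sym z) in xyz.
by rewrite ler_norml; apply/andP; split; lra.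
Qed.

Lemma mdist_continuous x : continuous (mdist x : M -> R).
Proof.
move=> y; apply/cvgrPdist_lt => e e0.
apply: filterS (nbhsx_ballx y e e0) => z; rewrite ballEmdist.
exact/le_lt_trans/ler_mdist_dist.
Qed.

(* The hypothesis makes [U] relatively clopen in the complement of [C]. *)
Lemma connected_component_avoid (A C : M) (U : set M) :
  U A -> (forall P Q, U P -> mdist P Q < mdist P C -> U Q) ->
  connected_component (~` [set C]) A `<=` U.
Proof.
move=> UA UPQ B [D [DA DC Dc]] DB.
have notC P : D P -> 0 < mdist P C.
  by move=> /DC PC; rewrite mdist_gt0; apply/eqP.
suff DU : D `&` U = D by move: DB; rewrite /= -DU => -[].
apply: Dc; first by exists A.
  exists (\bigcup_(P in [set P | U P /\ 0 < mdist P C])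
      (ball P (mdist P C))^°).
    by apply: bigcup_open => P _; exact: open_interior.
  apply/seteqP; split => P [DP] /=.
    move=> UP; split => //; exists P; first by split => //; exact: notC.
    by apply: nbhsx_ballx; exact: notC.
  move=> [Q [UQ _]] /interior_subset; rewrite ballEmdist /= => QP.
  by split => //; exact: UPQ QP.
(* The radius is halved so that a point of [U] within dist(Q, C)/2 of Q is closer to Q than to [C],
   which would put Q in [U]. *)
exists (~` \bigcup_(P in [set P | ~ U P /\ 0 < mdist P C])
    (ball P (mdist P C / 2))^°).
  by apply: open_closedC; apply: bigcup_open => P _; exact: open_interior.
apply/seteqP; split => P [DP] /=.
  move=> UP; split => // -[Q [nUQ _]] /interior_subset.
  rewrite ballEmdist /= => QP; apply: nUQ; apply: UPQ UP _.
  by have := metric_triangle Q P C; rewrite (metric_sym P Q); lra.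
move=> nP; split=> //; apply: contrapT => nUP; apply: nP.
exists P; first by split => //; exact: notC.
by apply: nbhsx_ballx; rewrite divr_gt0// notC.
Qed.

(** Only the values of [p] on [0, 1] are constrained. A Lipschitz constant replaces the length: it
    bounds the length, gives continuity, and behaves simply under concatenation. *)
Definition lipschitz_joined D L a b := exists p, [/\ p 0 = a, p 1 = b,
  (forall t, 0 <= t <= 1 -> D (p t)) &
  (forall s t, 0 <= s <= 1 -> 0 <= t <= 1 ->
    mdist (p s) (p t) <= L * `|s - t|)].

Lemma lipschitz_joined_le D L L' a b : L <= L' ->
  lipschitz_joined D L a b -> lipschitz_joined D L' a b.
Proof.
move=> LL' [p [p0 p1 pD pL]]; exists p; split=> // s t s01 t01.
by rewrite (le_trans (pL _ _ s01 t01))// ler_wpM2r.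
Qed.

Lemma lipschitz_joined_sub D D' L a b : D `<=` D' ->
  lipschitz_joined D L a b -> lipschitz_joined D' L a b.
Proof.
by move=> DD' [p [p0 p1 pD pL]]; exists p; split=> // t /pD /DD'.
Qed.

Lemma lipschitz_joined_refl D a : D a -> lipschitz_joined D 0 a a.
Proof.
by move=> Da; exists (cst a); split=> // s t _ _; rewrite mul0r mdistxx.
Qed.

(* Concatenating without reparametrizing by length costs a factor 2, which is
   harmless because only the existence of some linear bound matters. *)
Lemma lipschitz_joined_trans D L a b c :
  lipschitz_joined D L a b -> lipschitz_joined D L b c ->
  lipschitz_joined D (2 * L) a c.
Proof.
move=> [p [p0 p1 pD pL]] [q [q0 q1 qD qL]].
exists (fun t => if t <= 2^-1 then p (2 * t) else q (2 * t - 1)); split.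
- by rewrite ifT ?mulr0//; lra.
- by rewrite ifF ?mulr1 ?addrK//; apply/negbTE; rewrite -ltNge; lra.
- move=> t t01; case: ifPn => [?|]; first by apply: pD; lra.
  by rewrite -ltNge => ?; apply: qD; lra.
have cross s t : 0 <= s <= 1 -> 0 <= t <= 1 -> s <= 2^-1 -> 2^-1 < t ->
    mdist (p (2 * s)) (q (2 * t - 1)) <= 2 * L * `|s - t|.
  move=> s01 t01 s2 t2; apply: le_trans (metric_triangle _ b _) _.
  have /pL : 0 <= 2 * s <= 1 by lra.
  move=> /(_ 1) /[!p1]; have -> : `|2 * s - 1| = 1 - 2 * s by rewrite ler0_norm; lra.
  have /(_ (2 * t - 1)) := qL 0; rewrite q0.
  have -> : `|0 - (2 * t - 1)| = 2 * t - 1 by rewrite ler0_norm; lra.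
  have -> : `|s - t| = t - s by rewrite ler0_norm; lra.
  move=> h1 h2; have {}h1 : mdist b (q (2 * t - 1)) <= L * (2 * t - 1) by apply: h1; lra.
  have {}h2 : mdist (p (2 * s)) b <= L * (1 - 2 * s) by apply: h2; lra.
  by lra.
move=> s t s01 t01.
case: ifPn => [s2|]; case: ifPn => [t2|]; rewrite -?ltNge.
- have -> : 2 * L * `|s - t| = L * `|2 * s - 2 * t|.
    by rewrite -mulrBr normrM ger0_norm//; ring.
  by apply: pL; lra.
- by move=> t2; exact: cross.
- by move=> s2; rewrite metric_sym distrC; exact: cross.
- move=> t2 s2.
  have -> : 2 * L * `|s - t| = L * `|(2 * s - 1) - (2 * t - 1)|.
    have -> : (2 * s - 1) - (2 * t - 1) = 2 * (s - t) by ring.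
    by rewrite normrM ger0_norm//; ring.
  by apply: qL; lra.
Qed.

Lemma lipschitz_continuous01 p L :
  (forall s t, 0 <= s <= 1 -> 0 <= t <= 1 ->
    mdist (p s) (p t) <= L * `|s - t|) ->
  {within `[0, 1]%classic, continuous p}.
Proof.
move=> pL; apply/subspace_continuousP => s; rewrite /= in_itv /= => s01.
apply/metricType_numDomainType.cvgrPdist_lt => e e0.
(* [L] may be 0, so a larger, positive constant serves as divisor. *)
have K0 : 0 < `|L| + 1 by have := normr_ge0 L; lra.
rewrite near_withinE; near=> t; rewrite /= in_itv /= => t01.
apply: le_lt_trans (pL _ _ s01 t01) _.
apply: (@le_lt_trans _ _ ((`|L| + 1) * `|s - t|)).
  by rewrite ler_wpM2r//; have := ler_norm L; lra.
rewrite mulrC -ltr_pdivlMr//.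
by near: t; apply: (nbhsx_ballx s); rewrite divr_gt0.
Unshelve. all: by end_near. Qed.

Lemma lipschitz_joined_component D L a b :
  lipschitz_joined D L a b -> connected_component D a b.
Proof.
move=> [p [p0 p1 pD pL]].
apply: (@connected_component_max _ D (p @` `[0, 1]%classic)).
- by exists 0 => //=; rewrite in_itv /= lexx ler01.
- by move=> _ [t + <-]; rewrite /= in_itv /=; exact: pD.
- apply: connected_continuous_connected; first exact: segment_connected.
  exact: lipschitz_continuous01 pL.
- by exists 1 => //=; rewrite in_itv /= lexx ler01.
Qed.

(** Rescaling to [0, 1] lets geodesics of varying lengths, one for each n, be followed at a common
    time. *)
Lemma geodesic_affine a b g s t : geodesic a b g -> 0 <= s <= 1 -> 0 <= t <= 1 ->
  mdist (g (s * mdist a b)) (g (t * mdist a b)) = mdist a b * `|s - t|.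
Proof.
move=> [_ _ gD] /andP[s0 s1] /andP[t0 t1].
have ab0 := mdist_ge0 a b.
rewrite gD ?in_itv /= ?mulr_ge0 ?ler_piMl//.
by rewrite -mulrBl normrM mulrC (ger0_norm ab0).
Qed.

Lemma geodesic_affine0 a b g : geodesic a b g -> g (0 * mdist a b) = a.
Proof. by case=> g0 _ _; rewrite mul0r. Qed.

Lemma geodesic_affine1 a b g : geodesic a b g -> g (1 * mdist a b) = b.
Proof. by case=> _ g1 _; rewrite mul1r. Qed.

Lemma geodesic_lipschitz_joined a b : geodesic_space M ->
  lipschitz_joined [set z | mdist a z <= mdist a b] (mdist a b) a b.
Proof.
move=> /(_ a b)[g gab]; exists (fun t => g (t * mdist a b)); split.
- exact: geodesic_affine0.
- exact: geodesic_affine1.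
- move=> t t01 /=; rewrite -{1}(geodesic_affine0 gab) geodesic_affine//; last by lra.
  rewrite ler_piMr ?mdist_ge0// sub0r normrN ger0_norm; lra.
- by move=> s t s01 t01; rewrite geodesic_affine.
Qed.

Lemma geodesic_midpoint_dist a b c : geodesic_midpoint a b c ->
  mdist a c = mdist a b / 2 /\ mdist c b = mdist a b / 2.
Proof.
move=> [g gab ->].
rewrite [in g _](mulrC (mdist a b)).
have h0 : 0 <= (0 : R) <= 1 by lra.
have h1 : 0 <= (1 : R) <= 1 by lra.
have h2 : 0 <= (2^-1 : R) <= 1 by lra.
have := geodesic_affine gab h0 h2; have := geodesic_affine gab h2 h1.
rewrite (geodesic_affine0 gab) (geodesic_affine1 gab) => -> ->.
by rewrite sub0r normrN ger0_norm ?ler0_norm; [split; lra|lra..].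
Qed.

Lemma path_lt_le_last t (s : seq R) : path <%R t s -> t <= last t s.
Proof.
elim: s t => [|u s IH] t //= /andP[/ltW tu] /IH; exact: le_trans.
Qed.

Lemma sum_lipschitz_le p L t0 s : 0 <= t0 -> path <%R t0 s -> last t0 s <= 1 ->
  (forall s t, 0 <= s <= 1 -> 0 <= t <= 1 ->
    mdist (p s) (p t) <= L * `|s - t|) ->
  \sum_(i < size s) mdist (p (nth 0 (t0 :: s) i)) (p (nth 0 (t0 :: s) i.+1))
    <= L * (last t0 s - t0).
Proof.
move=> + + + pL; elim: s t0 => [|t s IH] t0 t00 /=.
  by rewrite big_ord0 subrr mulr0.
move=> /andP[t0t ts] s1; rewrite big_ord_recl /=.
have t_ge0 : 0 <= t by lra.
have t1 : t <= last t s by exact: path_lt_le_last.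
have {}IH := IH _ t_ge0 ts s1.
have : mdist (p t0) (p t) <= L * (t - t0).
  by rewrite -(ger0_norm (ltW _ : 0 <= t - t0)) ?subr_gt0// distrC pL//; lra.
have -> : L * (last t s - t0) = L * (t - t0) + L * (last t s - t) by ring.
by move=> h; apply: lerD.
Qed.

Lemma path_length_lipschitz p L :
  (forall s t, 0 <= s <= 1 -> 0 <= t <= 1 ->
    mdist (p s) (p t) <= L * `|s - t|) -> (path_length p <= L%:E)%E.
Proof.
move=> pL; apply: ge_ereal_sup => _ [s [s01 /eqP s1] <-].
have := sum_lipschitz_le (lexx 0) s01 _ pL.
by rewrite s1 subr0 mulr1 lee_fin; exact.
Qed.

Lemma divergence_le gamma delta a b c L :
  lipschitz_joined [set z | delta * Num.min (mdist c a) (mdist c b) - gamma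
    <= mdist c z] L a b ->
  (divergence gamma a b c delta <= L%:E)%E.
Proof.
move=> [p [p0 p1 pD pL]]; apply: le_trans (path_length_lipschitz pL).
apply: ereal_inf_lbound; exists p => //; split.
  by split=> //; exact: lipschitz_continuous01 pL.
move=> t; rewrite in_itv /= => /pD /=; rewrite ballEmdist /= => h.
by apply/negP; rewrite -leNgt.
Qed.

End MetricPaths.

(** * Cutting a path into a controlled number of short steps *)

Section PathSubdivision.
Context (R : realType) (M : metricType R).
Implicit Types (a b : M) (p : R -> M) (L eta t : R).

(** Either the endpoint is already within [eta], or the intermediate value theorem gives a later
    time at distance exactly [eta]. Exactness is what makes each unfinished step use up length
    [eta]. *)
Lemma path_next_time p eta t : 0 < eta -> {within `[0, 1]%classic, continuous p} ->
  0 <= t <= 1 -> exists t', [/\ t <= t' <= 1, mdist (p t) (p t') <= eta &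
    t' = 1 \/ t < t' /\ mdist (p t) (p t') = eta].
Proof.
move=> eta0 pc /andP[t0 t1].
have [le|] := pselect (mdist (p t) (p 1) <= eta).
  by exists 1; rewrite t1 lexx; split=> //; left.
move=> /negP; rewrite -ltNge => gt.
have fc : {within `[t, 1]%classic, continuous (mdist (p t) \o p)}.
  apply: within_continuous_comp; first by move=> x _; exact: mdist_continuous.
  apply: continuous_subspaceW pc => u /=; rewrite !in_itv /= => /andP[tu ->].
  by rewrite (le_trans t0 tu).
have [|u] := IVT (v := eta) t1 fc.
  by rewrite /= mdistxx ge_min le_max (ltW eta0) (ltW gt) orbT.
rewrite in_itv /= => /andP[tu u1] pu; exists u; rewrite tu u1 pu lexx.
split=> //; right; split=> //; rewrite lt_neqAle tu andbT.
by apply: contraTneq eta0 => tu'; rewrite -pu /= tu' mdistxx ltxx.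
Qed.

Lemma path_length_ge_sum p (t : nat -> R) N : t 0%N = 0 ->
  (forall i, (i < N)%N -> t i < t i.+1) -> t N < 1 ->
  ((\sum_(i < N) mdist (p (t i)) (p (t i.+1)))%:E <= path_length p)%E.
Proof.
(* A partition omits 0 and must end at 1, so 1 is appended to the times; the extra last term of the
   sum is nonnegative and is dropped. *)
move=> t0 tS tN1; pose s := rcons [seq t i | i <- iota 1 N] 1.
have sE : 0 :: s = rcons [seq t i | i <- iota 0 N.+1] 1 by rewrite /= t0.
have size_s : size s = N.+1 by rewrite size_rcons size_map size_iota.
have nth_s i : (i <= N)%N -> nth 0 (0 :: s) i = t i.
  move=> iN; rewrite sE nth_rcons size_map size_iota ltnS iN.
  by rewrite (nth_map 0%N) ?size_iota// nth_iota.
have nth_sN : nth 0 (0 :: s) N.+1 = 1.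
  by rewrite sE nth_rcons size_map size_iota ltnn eqxx.
have s01 : itv_partition 0 1 s.
  split; last by rewrite last_rcons.
  apply/(pathP 0) => i; rewrite size_s ltnS leq_eqVlt => /orP[/eqP->|iN].
    by rewrite -[nth 0 s N]/(nth 0 (0 :: s) N.+1) nth_sN nth_s.
  rewrite -[nth 0 s i]/(nth 0 (0 :: s) i.+1) !nth_s//; first exact: tS.
  exact: ltnW.
apply: le_trans (ereal_sup_ubound _); last by exists s => //; reflexivity.
rewrite lee_fin size_s big_ord_recr /= ler_wpDr ?mdist_ge0//.
apply: ler_sum => i _; rewrite nth_s ?(ltnW (ltn_ord i))//.
by rewrite -[nth 0 s i]/(nth 0 (0 :: s) i.+1) nth_s.
Qed.

(** Greedy subdivision: if time 1 were not reached after [N] steps, all of them would have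
    displacement exactly [eta], and the length would be at least [eta * N], which exceeds [L]. Once
    time 1 is reached the sequence stays at [b]. *)
Lemma path_subdivision a b p L eta N : path_between a b p ->
  (path_length p <= L%:E)%E -> 0 < eta -> L < eta * N%:R ->
  exists x : nat -> M, [/\ x 0%N = a, x N = b,
    forall i, mdist (x i) (x i.+1) <= eta &
    forall i, exists2 t, 0 <= t <= 1 & x i = p t].
Proof.
move=> [pc p0 p1] pL eta0 LN.
have /choice[next nextP] t : exists t', 0 <= t <= 1 ->
    [/\ t <= t' <= 1, mdist (p t) (p t') <= eta &
    t' = 1 \/ t < t' /\ mdist (p t) (p t') = eta].
  have [t01|] := pselect (0 <= t <= 1); last by move=> ?; exists 0.
  by have [t' ?] := path_next_time eta0 pc t01; exists t'.
pose t i := iter i next 0.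
have t01 i : 0 <= t i <= 1.
  elim: i => [|i IH] /=; first by rewrite lexx ler01.
  have [/andP[ti ->] _ _] := nextP _ IH.
  by rewrite andbT (le_trans _ ti)//; case/andP: IH.
have t_eq1 i j : t i = 1 -> (i <= j)%N -> t j = 1.
  move=> ti /subnK <-; elim: (j - i)%N => // k IH.
  rewrite addSn; have [+ _ _] := nextP _ (t01 (k + i)%N).
  by rewrite -[next _]/(t _.+1) IH => /andP[h1 h2]; apply/eqP; rewrite eq_le h1 h2.
exists (p \o t); split=> //=; last 2 first.
- by move=> i; have [] := nextP _ (t01 i).
- by move=> i; exists (t i).
suff -> : t N = 1 by [].
apply: contrapT => tN1.
have tS i : (i < N)%N -> t i < t i.+1 /\ mdist (p (t i)) (p (t i.+1)) = eta.
  move=> iN; have [_ _ [ti1|//]] := nextP _ (t01 i).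
  by exfalso; apply: tN1; apply: t_eq1 iN.
have tN : t N < 1.
  by rewrite lt_neqAle; case/andP: (t01 N) => _ ->; rewrite andbT; exact/eqP.
have := path_length_ge_sum p (erefl _) (fun i iN => (tS i iN).1) tN.
move=> /le_trans/(_ pL); rewrite lee_fin.
rewrite (eq_bigr (fun=> eta)) => [|i _]; last by rewrite (tS _ _).2.
by rewrite sumr_const card_ord -[_ *+ _]mulr_natr leNgt LN.
Qed.

End PathSubdivision.

(** * Transfer between sequences in X and points of the cone *)

Section ConeLimits.
Context (R : realType) (X : metricType R) (omega : set_system nat).
Context (omegaU : UltraFilter omega) (o : nat -> X) (d : nat -> R).
Context (d_gt0 : forall n, 0 < d n).
Implicit Types x y z a b c : nat -> X.

Local Notation Cone := (Con omegaU o d_gt0).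
Local Notation inC := (in_cone omega o d).
Local Notation cls := (cone_class omegaU d_gt0).

Lemma in_cone_cvg x y : inC x -> inC y -> cvg (scaled_dist d x y @ omega).
Proof.
move=> hx hy.
exact: (@cvg_scaled_dist _ _ _ omegaU o d d_gt0 (ConeSeq hx) (ConeSeq hy)).
Qed.

(** Strict inequalities pass from the cone to omega-almost all n, weak ones only back to the cone;
    hence the slack in later bounds such as [D + 1]. *)
Lemma cone_class_lt x y (hx : inC x) (hy : inC y) m :
  mdist (cls hx) (cls hy) < m ->
  \forall n \near omega, mdist (x n) (y n) < m * d n.
Proof.
rewrite mdist_cone_class => /(cvgr_lt _ (in_cone_cvg hx hy)) h.
by apply: filterS h => n; rewrite /scaled_dist ltr_pdivrMr.
Qed.

Lemma cone_class_gt x y (hx : inC x) (hy : inC y) m :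
  m < mdist (cls hx) (cls hy) ->
  \forall n \near omega, m * d n < mdist (x n) (y n).
Proof.
rewrite mdist_cone_class => /(cvgr_gt _ (in_cone_cvg hx hy)) h.
by apply: filterS h => n; rewrite /scaled_dist ltr_pdivlMr.
Qed.

Lemma cone_class_le x y (hx : inC x) (hy : inC y) m :
  (\forall n \near omega, mdist (x n) (y n) <= m * d n) ->
  mdist (cls hx) (cls hy) <= m.
Proof.
rewrite mdist_cone_class => h; apply: limr_le.
  exact: (in_cone_cvg hx hy).
by apply: filterS h => n; rewrite /scaled_dist ler_pdivrMr.
Qed.

Lemma cone_class_ge x y (hx : inC x) (hy : inC y) m :
  (\forall n \near omega, m * d n <= mdist (x n) (y n)) ->
  m <= mdist (cls hx) (cls hy).
Proof.
rewrite mdist_cone_class => h; apply: limr_ge.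
  exact: (in_cone_cvg hx hy).
by apply: filterS h => n; rewrite /scaled_dist ler_pdivlMr.
Qed.

Lemma in_cone_near x y m : inC x ->
  (\forall n \near omega, mdist (y n) (x n) <= m * d n) -> inC y.
Proof.
move=> /(cvg_ultra_bounded omegaU)[k xk] yx.
apply: (in_cone_bounded omegaU d_gt0 (M := m + k)).
apply: filterS2 xk yx => n xk yx.
apply: le_trans (scaled_dist_triangle d_gt0 x _ _ _) _.
by rewrite lerD// /scaled_dist ler_pdivrMr.
Qed.

Lemma cone_classP (P : Cone) : exists x (hx : inC x), P = cls hx.
Proof.
rewrite -[P]reprK; case: (repr P) => x hx.
by exists x, hx.
Qed.

Lemma cone_class_eq x y (hx : inC x) (hy : inC y) :
  (\forall n \near omega, x n = y n) -> cls hx = cls hy.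
Proof.
move=> xy; apply/mdist_positivity/eqP; rewrite eq_le mdist_ge0 andbT.
by apply: cone_class_le; apply: filterS xy => n ->; rewrite mdistxx mul0r.
Qed.

(** Membership in the cone bounds the scaled distances only omega-almost surely, whereas
    [superlinear_divergence] asks for a bound at every n. Replacing the exceptional terms by [o n]
    does not change the class. *)
Lemma cone_class_bounded (P : Cone) : exists x (hx : inC x),
  P = cls hx /\ bounded_fun (fun n => mdist (x n) (o n) / d n : R^o).
Proof.
have [x [hx Px]] := cone_classP P.
have [m xm] := cvg_ultra_bounded omegaU hx.
pose y n := if scaled_dist d x o n <= m then x n else o n.
have xy : \forall n \near omega, x n = y n.
  by apply: filterS xm => n; rewrite /y => ->.
have hy : inC y.
  by apply: (in_cone_near (m := 0) hx); apply: filterS xy => n ->; rewrite mdistxx mul0r.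
exists y, hy; split; first by rewrite Px; exact: cone_class_eq.
exists `|m|; split; first exact: num_real.
move=> k mk n _ /=; rewrite ger0_norm ?divr_ge0 ?mdist_ge0 ?(ltW (d_gt0 n))//.
apply/ltW/le_lt_trans/mk; rewrite /y; case: ifPn => [h|_].
  by rewrite (le_trans h)// ler_norm.
by rewrite mdistxx mul0r.
Qed.

(** The limit of the geodesics [g n] taken at proportional times. The last clause identifies its
    points, so that the class of a sequence of midpoints can be recognised at time 1/2. *)
Lemma cone_segment x y (hx : inC x) (hy : inC y) (g : nat -> R -> X) :
  (forall n, geodesic (x n) (y n) (g n)) ->
  exists gamma : R -> Cone, [/\ gamma 0 = cls hx, gamma 1 = cls hy,
    forall s t, 0 <= s <= 1 -> 0 <= t <= 1 ->
      mdist (gamma s) (gamma t) = mdist (cls hx) (cls hy) * `|s - t| &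
    forall t (ht : inC (fun n => g n (t * mdist (x n) (y n)))),
      0 <= t <= 1 -> gamma t = cls ht].
Proof.
move=> gP; pose z t n := g n (t * mdist (x n) (y n)).
set D := mdist (cls hx) (cls hy).
have zz s t n : 0 <= s <= 1 -> 0 <= t <= 1 ->
    mdist (z s n) (z t n) = mdist (x n) (y n) * `|s - t|.
  by move=> s01 t01; rewrite geodesic_affine.
have z0 : z 0 = x by apply/funext => n; rewrite /z (geodesic_affine0 (gP n)).
have z1 : z 1 = y by apply/funext => n; rewrite /z (geodesic_affine1 (gP n)).
have hz t : 0 <= t <= 1 -> inC (z t).
  move=> t01; apply: (in_cone_near (m := D + 1) hx).
  have : D < D + 1 by rewrite ltrDl.
  move=> /cone_class_lt; apply: filterS => n /ltW; apply: le_trans.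
  rewrite -z0 zz//; last by rewrite lexx ler01.
  by rewrite z0 ler_piMr ?mdist_ge0// subr0 ger0_norm; lra.
(* Points outside [0, 1] get a default value; inside, the class does not depend on the proof of
   membership in the cone. *)
have /choice[gamma gammaP] t : exists G : Cone, 0 <= t <= 1 ->
    forall ht : inC (z t), G = cls ht.
  have [t01|] := pselect (0 <= t <= 1); last by exists (cls hx).
  by exists (cls (hz _ t01)) => _ ht; rewrite (Prop_irrelevance ht (hz _ t01)).
exists gamma; split.
- rewrite (gammaP 0 _ (hz _ _)) ?lexx ?ler01// => h.
  by apply: cone_class_eq; apply: nearW => n; rewrite z0.
- rewrite (gammaP 1 _ (hz _ _)) ?lexx ?ler01// => h.
  by apply: cone_class_eq; apply: nearW => n; rewrite z1.
- move=> s t s01 t01.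
  rewrite (gammaP s s01 (hz s s01)) (gammaP t t01 (hz t t01)) /D !mdist_cone_class.
  have -> : scaled_dist d (z s) (z t) = scaled_dist d x y \* cst `|s - t|.
    by apply/funext => n; rewrite /scaled_dist zz//= mulrAC.
  apply: cvg_lim => //; apply: cvgM; last exact: cvg_cst.
  exact: in_cone_cvg.
- by move=> t ht t01; exact: gammaP.
Qed.

Lemma cone_geodesic (P Q : Cone) : geodesic_space X ->
  exists gamma : R -> Cone, [/\ gamma 0 = P, gamma 1 = Q &
    forall s t, 0 <= s <= 1 -> 0 <= t <= 1 ->
      mdist (gamma s) (gamma t) = mdist P Q * `|s - t|].
Proof.
move=> Xgeo; have [x [hx ->]] := cone_classP P; have [y [hy ->]] := cone_classP Q.
have /choice[g gP] n := Xgeo (x n) (y n).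
by have [gamma [? ? ? _]] := cone_segment hx hy gP; exists gamma.
Qed.

(** All points of a segment from [P] to [Q] are within dist(P, Q) of [P], so the segment misses
    [C]. *)
Lemma cone_component_ball (P Q C : Cone) : geodesic_space X ->
  mdist P Q < mdist P C -> connected_component (~` [set C]) P Q.
Proof.
move=> /(cone_geodesic P Q)[gamma [g0 g1 gD]] PQC.
apply: (@lipschitz_joined_component _ _ _ (mdist P Q)); exists gamma; split=> //.
  move=> t t01 /= tC; move: PQC; rewrite -tC -{2}g0 gD ?lexx ?ler01//.
  by rewrite ltNge ler_piMr ?mdist_ge0// sub0r normrN ger0_norm; lra.
by move=> s t s01 t01; rewrite gD.
Qed.

End ConeLimits.

(** * From superlinear divergence to a cut-point *)

Section CutPointDivergence.
Context (R : realType) (X : metricType R) (omega : set_system nat).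
Context (omegaU : UltraFilter omega) (o : nat -> X) (d : nat -> R).
Context (d_gt0 : forall n, 0 < d n).
Context (Xgeo : geodesic_space X).
Implicit Types x y z a b c : nat -> X.

Local Notation Cone := (Con omegaU o d_gt0).
Local Notation inC := (in_cone omega o d).
Local Notation cls := (cone_class omegaU d_gt0).

(** The constants [K] and [e] do not depend on n but may vary with the pair: each new step may
    enlarge [K] and shrink [e], and the clopen argument asks for no uniformity. *)
Definition linearly_joined c x y := exists K e : R, 0 < e /\
  \forall n \near omega,
    lipschitz_joined [set z | e * d n <= mdist (c n) z] (K * d n) (x n) (y n).

Lemma linearly_joined_refl c x (hc : inC c) (hx : inC x) :
  cls hx <> cls hc -> linearly_joined c x x.
Proof.
move=> /eqP; rewrite -mdist_gt0 => xc.
exists 0, (mdist (cls hx) (cls hc) / 2); split; first by rewrite divr_gt0.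
have : mdist (cls hx) (cls hc) / 2 < mdist (cls hx) (cls hc) by lra.
move=> /cone_class_gt; apply: filterS => n h; rewrite mul0r.
by apply: lipschitz_joined_refl; rewrite /= (metric_sym (c n)) ltW.
Qed.

Lemma linearly_joined_step c a x y (hc : inC c) (hx : inC x) (hy : inC y) :
  linearly_joined c a x -> mdist (cls hx) (cls hy) < mdist (cls hx) (cls hc) ->
  linearly_joined c a y.
Proof.
move=> [K [e [e0 ax]]] xyc.
set D := mdist (cls hx) (cls hy) in xyc; set E := mdist (cls hx) (cls hc) in xyc.
(* Almost surely the geodesic from [x n] has length below (D + u) d_n and starts at distance above
   (E - u) d_n from [c n]. It thus stays at distance (E - D - 2u) d_n = u d_n or more from [c n]. *)
pose u := (E - D) / 3.
have u0 : 0 < u by rewrite divr_gt0 ?subr_gt0.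
exists (2 * Num.max K (D + u)), (Num.min e u); split; first by rewrite lt_min e0.
have /cone_class_lt xy : D < D + u by lra.
have /cone_class_gt xc : E - u < E by lra.
apply: filterS3 ax xy xc => n ax xy xc.
rewrite -mulrA; apply: (lipschitz_joined_trans (b := x n)).
  apply: lipschitz_joined_le (lipschitz_joined_sub _ ax).
    by rewrite ler_wpM2r ?(ltW (d_gt0 n))// le_max lexx.
  move=> z /=; apply: le_trans.
  by rewrite ler_wpM2r ?(ltW (d_gt0 n))// ge_min lexx.
apply: lipschitz_joined_le (lipschitz_joined_sub _ (geodesic_lipschitz_joined _ _ Xgeo)).
  by rewrite (le_trans (ltW xy))// ler_wpM2r ?(ltW (d_gt0 n))// le_max lexx orbT.
move=> z /= xz.
apply: (@le_trans _ _ (u * d n)).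
  by rewrite ler_wpM2r ?(ltW (d_gt0 n))// ge_min lexx orbT.
have := metric_triangle (x n) z (c n); rewrite (metric_sym z).
suff -> : u * d n = (E - u) * d n - (D + u) * d n by lra.
by rewrite -mulrBl; congr (_ * _); rewrite /u; field.
Qed.

Lemma component_linearly_joined c a b (hc : inC c) (ha : inC a) (hb : inC b) :
  cls ha <> cls hc ->
  connected_component (~` [set cls hc]) (cls ha) (cls hb) ->
  linearly_joined c a b.
Proof.
move=> ac ab.
have bc : cls hb <> cls hc by have := connected_component_sub ab.
pose U := [set P : Cone | exists x (hx : inC x), P = cls hx /\ linearly_joined c a x].
have : U (cls hb).
  apply: (connected_component_avoid _ _ ab).
    by exists a, ha; split=> //; exact: linearly_joined_refl ac.
  move=> _ Q [x [hx [-> ax]]]; have [y [hy ->]] := cone_classP Q => xyc.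
  by exists y, hy; split=> //; exact: linearly_joined_step ax xyc.
move=> [x [hx [bx ax]]].
(* [U] only provides some representative [x] of the class of [b]; a step of length 0 in the cone
   passes from [x] to [b] itself. *)
apply: (linearly_joined_step (hc := hc) (hy := hb) ax).
by rewrite -bx mdistxx mdist_gt0; exact/eqP.
Qed.

Lemma superlinear_separates a b c : superlinear_divergence omega o d a b c ->
  exists (ha : inC a) (hb : inC b) (hc : inC c),
    separates (cls hc) (cls ha) (cls hb).
Proof.
move=> [[K K1 abd] abnd bbnd cmid div].
have mid n := geodesic_midpoint_dist (cmid n).
have K0 : 0 < K by lra.
have in_bounded z : bounded_fun (fun n => mdist (z n) (o n) / d n : R^o) -> inC z.
  move=> [m [_ /(_ (m + 1))]]; rewrite ltrDl => /(_ ltr01) zm.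
  apply: (in_cone_bounded omegaU d_gt0 (M := m + 1)); apply: nearW => n.
  by have := zm n I; exact/le_trans/ler_norm.
have ha := in_bounded _ abnd; have hb := in_bounded _ bbnd.
have ab_gt : \forall n \near omega, d n <= K * mdist (a n) (b n).
  by apply: filterS abd => n /andP[_ /ltW].
have hc : inC c.
  apply: (in_cone_near omegaU d_gt0 (m := K) ha) => //; apply: filterS abd => n /andP[+ _].
  rewrite ltr_pdivrMl// (metric_sym (c n)) (mid n).1 => h.
  by have := mdist_ge0 (a n) (b n); lra.
(* The lower half of the two-sided [bigO_omega] keeps the midpoint at linear distance from both
   ends, so A and B differ from C. *)
have acn : \forall n \near omega, (2 * K)^-1 * d n <= mdist (a n) (c n).
  apply: filterS ab_gt => n h; rewrite (mid n).1 ler_pdivrMl ?mulr_gt0//.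
  by have -> : 2 * K * (mdist (a n) (b n) / 2) = K * mdist (a n) (b n) by field.
exists ha, hb, hc.
have K2 : 0 < (2 * K)^-1 by rewrite invr_gt0 mulr_gt0.
have ac : (2 * K)^-1 <= mdist (cls ha) (cls hc) by exact: cone_class_ge.
have bc : (2 * K)^-1 <= mdist (cls hb) (cls hc).
  apply: cone_class_ge; apply: filterS acn => n.
  by rewrite (mid n).1 -(mid n).2 (metric_sym (c n)).
have acN : cls ha <> cls hc by move=> h; move: ac; rewrite h mdistxx leNgt K2.
have bcN : cls hb <> cls hc by move=> h; move: bc; rewrite h mdistxx leNgt K2.
split=> // /(component_linearly_joined acN)[L [e [e0 ab]]].
set D := mdist (cls ha) (cls hc) in ac.
have D1 : 0 < D + 1 by lra.
(* The radius in the divergence is at most [delta * (D + 1) * d n], hence at most [e * d n], so with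
   [gamma] = 0 the joining paths avoid the ball. The cap 1/2 keeps [delta] below 1. *)
pose delta := Num.min 2^-1 (e / (D + 1)).
have delta01 : 0 < delta < 1.
  by rewrite lt_min gt_min divr_gt0//; apply/andP; split; [|apply/orP; left]; lra.
have /cvgeyPgt/(_ L) {}div := div delta 0 delta01 (lexx 0).
have : D < D + 1 by rewrite ltrDl.
move=> /cone_class_lt /(filterI ab)/(filterI div) /filter_ex[n [Ln [{}ab acDn]]].
move: Ln; apply/negP; rewrite -leNgt lee_pdivrMr// -EFinM.
apply: divergence_le; apply: lipschitz_joined_sub ab => z /=; apply: le_trans.
rewrite subr0; apply: (@le_trans _ _ (delta * ((D + 1) * d n))).
  rewrite ler_wpM2l ?(ltW (andP delta01).1)// ge_min.
  by rewrite (metric_sym (c n)) ltW.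
rewrite mulrA ler_wpM2r ?(ltW (d_gt0 n))//.
by rewrite -ler_pdivlMr// ge_min lexx orbT.
Qed.

End CutPointDivergence.

(** * From a cut-point to superlinear divergence *)

Section DivergenceFromCutPoint.
Context (R : realType) (X : metricType R) (omega : set_system nat).
Context (omegaU : UltraFilter omega) (o : nat -> X) (d : nat -> R).
Context (d_gt0 : forall n, 0 < d n).
Context (Xgeo : geodesic_space X).
Implicit Types x y z a b c : nat -> X.

Local Notation Cone := (Con omegaU o d_gt0).
Local Notation inC := (in_cone omega o d).
Local Notation cls := (cone_class omegaU d_gt0).

Lemma not_connected_separates (C : Cone) : cut_point C ->
  exists A B, separates C A B.
Proof.
move=> Ccut; apply: contrapT => noAB; apply: Ccut.
have [->|/set0P[A AC]] := eqVneq (~` [set C]) set0; first exact: connected0.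
suff <- : connected_component (~` [set C]) A = ~` [set C].
  exact: component_connected.
apply/seteqP; split; first exact: connected_component_sub.
by move=> B BC; apply: contrapT => AB; apply: noAB; exists A, B; split.
Qed.

Lemma separates_sym (C A B : Cone) : separates C A B -> separates C B A.
Proof.
by move=> [? ? AB]; split=> // BA; apply: AB; exact: connected_component_sym.
Qed.

Lemma separates_component (C A B A' : Cone) : separates C A B ->
  connected_component (~` [set C]) A A' -> separates C A' B.
Proof.
move=> [AC BC AB] AA'; split=> //; first by have := connected_component_sub AA'.
by move=> A'B; apply: AB; exact: connected_component_trans AA' A'B.
Qed.

(** The farther point is moved towards [C] until it is as close as the other one. It travels less
    than its distance to [C], so it stays in its component. *)
Lemma separates_equidistant (C A B : Cone) : separates C A B ->
  exists A' B', separates C A' B' /\ mdist A' C = mdist B' C.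
Proof.
wlog AB : A B / mdist B C <= mdist A C => [wlg|] sep.
  have [|/ltW] := leP (mdist B C) (mdist A C); first by move=> /wlg; exact.
  by move=> /wlg; apply; exact: separates_sym.
have [AC BC _] := sep.
have BC0 : 0 < mdist B C by rewrite mdist_gt0; exact/eqP.
have AC0 : 0 < mdist A C by rewrite mdist_gt0; exact/eqP.
have [gamma [g0 g1 gD]] := cone_geodesic A C Xgeo.
pose t := 1 - mdist B C / mdist A C.
have q1 : mdist B C / mdist A C <= 1 by rewrite ler_pdivrMr// mul1r.
have q0 : 0 < mdist B C / mdist A C by rewrite divr_gt0.
have t01 : 0 <= t <= 1 by rewrite /t; lra.
exists (gamma t), B; split.
  apply: separates_component sep _; apply: cone_component_ball => //.
  rewrite -{1}g0 gD ?lexx ?ler01// sub0r normrN ger0_norm; last by case/andP: t01.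
  by rewrite gtr_pMr//; rewrite /t; lra.
rewrite -{1}g1 gD ?lexx ?ler01// ler0_norm /t; last lra.
by field; rewrite gt_eqF.
Qed.

(** The limit of the geodesics [a_n, b_n] must meet [C], or it would join A to B in the complement;
    equidistance then forces the meeting time to be 1/2. *)
Lemma separates_midpoint a b c (ha : inC a) (hb : inC b) (C : Cone) :
  separates C (cls ha) (cls hb) -> mdist (cls ha) C = mdist (cls hb) C ->
  (forall n, geodesic_midpoint (a n) (b n) (c n)) ->
  exists hc : inC c, C = cls hc.
Proof.
move=> [_ _ AB] eqd mid.
(* Geodesics need not be unique: those chosen are the ones of which the [c n] are midpoints. *)
have /choice[g gP] n : exists g, geodesic (a n) (b n) g /\
    c n = g (2^-1 * mdist (a n) (b n)).
  by have [g ? ->] := mid n; exists g; rewrite mulrC.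
have cE : c = (fun n => g n (2^-1 * mdist (a n) (b n))).
  by apply/funext => n; exact: (gP n).2.
have [gamma [g0 g1 gD gE]] := cone_segment omegaU d_gt0 ha hb (fun n => (gP n).1).
set D := mdist (cls ha) (cls hb) in gD.
have hc : inC c.
  apply: (in_cone_near omegaU d_gt0 (m := D + 1) ha).
  have /cone_class_lt : D < D + 1 by rewrite ltrDl.
  apply: filterS => n h; rewrite (metric_sym (c n)).
  rewrite (geodesic_midpoint_dist (mid n)).1.
  by have := mdist_ge0 (a n) (b n); lra.
exists hc.
have half : 0 <= (2^-1 : R) <= 1 by lra.
have -> : cls hc = gamma 2^-1.
  move: hc; rewrite cE => hc'; exact/esym/gE.
have [t t01 tC] : exists2 t : R, 0 <= t <= 1 & gamma t = C.
  apply: contrapT => noC; apply: AB.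
  apply: (@lipschitz_joined_component _ _ _ D); exists gamma; split=> //.
    by move=> t t01 /= tC; apply: noC; exists t.
  by move=> s t s01 t01; rewrite gD.
rewrite -tC; apply/mdist_positivity; rewrite gD//.
have aC : mdist (cls ha) C = D * t.
  by rewrite -g0 -tC gD ?lexx ?ler01// sub0r normrN ger0_norm//; lra.
have bC : mdist (cls hb) C = D * (1 - t).
  by rewrite -g1 -tC gD ?lexx ?ler01// ger0_norm//; lra.
move: eqd; rewrite aC bC.
have [->|D0] := eqVneq D 0; first by move=> _; rewrite mul0r.
move=> /(mulfI D0) tt; have -> : t = 2^-1 by lra.
by rewrite subrr normr0 mulr0.
Qed.

Lemma separates_superlinear a b c (ha : inC a) (hb : inC b) (hc : inC c)
    (delta gamma : R) :
  d @ omega --> +oo -> separates (cls hc) (cls ha) (cls hb) -> 0 < delta ->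
  (fun n => divergence gamma (a n) (b n) (c n) delta * (d n)^-1%:E)%E
    @ omega --> +oo%E.
Proof.
move=> /cvgryPgt dy [/eqP AC /eqP BC AB] delta0; apply/cvgeyPgt => L.
(* In an ultrafilter the negation yields divergence at most L d_n almost surely, rather than just
   for some n. *)
have [//|short] := in_ultra_setVsetC
  [set n | (L%:E < divergence gamma (a n) (b n) (c n) delta * (d n)^-1%:E)%E] omegaU.
exfalso; apply: AB.
set A := cls ha; set B := cls hb; set C := cls hc.
pose rho := Num.min (mdist A C) (mdist B C) / 2.
have AC0 : 0 < mdist A C by rewrite mdist_gt0.
have BC0 : 0 < mdist B C by rewrite mdist_gt0.
have rho0 : 0 < rho by rewrite divr_gt0// lt_min AC0.
have rhoA : rho < mdist A C.
  by rewrite /rho; case: (leP (mdist A C) (mdist B C)); lra.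
have rhoB : rho < mdist B C.
  by rewrite /rho; case: (leP (mdist A C) (mdist B C)); lra.
(* Paths avoiding the ball stay at distance at least [delta * rho * d n - gamma] from [c n]. Half of
   the main term absorbs [gamma], since d_n tends to infinity. *)
pose e := delta * rho / 2.
have e0 : 0 < e by rewrite divr_gt0// mulr_gt0.
pose eta := e / 2.
have eta0 : 0 < eta by rewrite divr_gt0.
(* The infimum need not be attained; as [L'] exceeds [L], some path is shorter than [L' * d n]. *)
pose L' := Num.max L 0 + 1.
(* Step size and length bound both scale with d_n, so one [N] serves for all n and the chain has a
   limit of [N] steps. *)
have [N LN] : exists N : nat, L' < eta * N%:R.
  exists (Num.truncn (L' / eta)).+1.
  by rewrite mulrC -ltr_pdivrMr// truncnS_gt.
pose is_chain n (x : nat -> X) := [/\ x 0%N = a n, x N = b n,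
    forall i, mdist (x i) (x i.+1) <= eta * d n &
    forall i, e * d n <= mdist (x i) (c n)].
have chain : \forall n \near omega, exists x, is_chain n x.
  have /cone_class_gt an := rhoA; have /cone_class_gt bn := rhoB.
  have gn := dy (gamma / e).
  apply: filterS (filterI short (filterI an (filterI bn gn))).
  move=> n [/= /negP + [{}an [{}bn {}gn]]]; rewrite -leNgt lee_pdivrMr//.
  rewrite -EFinM => div.
  have : (divergence gamma (a n) (b n) (c n) delta < (L' * d n)%:E)%E.
    apply: le_lt_trans div _; rewrite lte_fin ltr_pM2r//.
    by rewrite ltr_pwDr// le_max lexx.
  move=> /ereal_inf_lt[_ [p [pab pC] <-] /ltW pL].
  have [||x [x0 xN xS xp]] := path_subdivision pab pL (eta := eta * d n) (N := N).
  - by rewrite mulr_gt0.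
  - by rewrite mulrAC ltr_pM2r.
  exists x; split=> // i; have [t t01 ->] := xp i.
  have : t \in `[0, 1] by rewrite in_itv.
  move=> /pC; rewrite ballEmdist /= => /negP; rewrite -leNgt (metric_sym (p t)).
  apply: le_trans; rewrite lerBrDr.
  apply: (@le_trans _ _ (delta * (rho * d n))); last first.
    by rewrite ler_wpM2l ?(ltW delta0)// le_min !(metric_sym (c n)) (ltW an) (ltW bn).
  move: gn; rewrite ltr_pdivrMr// => gn.
  have -> : delta * (rho * d n) = e * d n + d n * e by rewrite /e; field.
  by rewrite lerD2l ltW.
have /choice[x xP] n : exists x, (exists x, is_chain n x) -> is_chain n x.
  have [[x xn]|no] := pselect (exists x, is_chain n x); first by exists x.
  by exists (cst (a n)).
have {xP}chain : \forall n \near omega, is_chain n (x n).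
  by apply: filterS chain => n /xP.
suff reach i : exists hi : inC (x ^~ i),
    connected_component (~` [set C]) A (cls hi).
  have [hN AN] := reach N; rewrite (_ : B = cls hN)//.
  by apply: cone_class_eq; apply: filterS chain => n [].
elim: i => [|i [hi Ai]].
  have h0 : inC (x ^~ 0%N).
    apply: (in_cone_near omegaU d_gt0 (m := 0) ha).
    by apply: filterS chain => n [-> _ _ _]; rewrite mdistxx mul0r.
  exists h0; rewrite (_ : cls h0 = A); last first.
    by apply: cone_class_eq; apply: filterS chain => n [].
  by apply: connected_component_refl => /eqP; exact/negP.
have hi1 : inC (x ^~ i.+1).
  apply: (in_cone_near omegaU d_gt0 (m := eta) hi).
  by apply: filterS chain => n [_ _ + _]; rewrite metric_sym.
exists hi1; apply: connected_component_trans Ai _.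
(* In the cone each step is at most [eta], which is less than [e], while the chain stays at distance
   at least [e] from [C]. *)
apply: cone_component_ball => //; apply: (@le_lt_trans _ _ eta).
  by apply: cone_class_le; apply: filterS chain => n [_ _ + _].
apply: (@lt_le_trans _ _ e); first by rewrite /eta; lra.
by apply: cone_class_ge; apply: filterS chain => n [_ _ _].
Qed.

Lemma cut_point_superlinear (C : Cone) : d @ omega --> +oo -> cut_point C ->
  exists a b c, superlinear_divergence omega o d a b c.
Proof.
move=> dy /not_connected_separates[A0 [B0 /separates_equidistant]].
move=> [A [B [sep eqd]]].
have [a [ha [Aa abnd]]] := cone_class_bounded A.
have [b [hb [Bb bbnd]]] := cone_class_bounded B.
have /choice[c cP] n : exists m : X, geodesic_midpoint (a n) (b n) m.
  have [g gab] := Xgeo (a n) (b n).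
  by exists (g (mdist (a n) (b n) / 2)), g.
subst A B; have [hc Cc] := separates_midpoint sep eqd cP; subst C.
exists a, b, c; split=> //; last first.
  by move=> delta gamma /andP[delta0 _] _; exact: separates_superlinear sep delta0.
set D := mdist (cls ha) (cls hb).
have D0 : 0 < D.
  rewrite mdist_gt0; apply/eqP => AB; case: sep => AC _; apply.
  by rewrite -AB; exact: connected_component_refl.
(* The bounds D < K and 1/K < D give the two halves of [bigO_omega]. *)
have [K [K1 KD DK]] : exists K, [/\ 1 < K, D < K & K^-1 < D].
  exists (1 + D + D^-1); have Di : 0 < D^-1 by rewrite invr_gt0.
  split; [lra..|]; rewrite -[ltRHS]invrK ltf_pV2 ?posrE//; lra.
have K0 : 0 < K by lra.
have /cone_class_lt ab := KD; have /cone_class_gt ba := DK.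
exists K => //; apply: filterS2 ab ba => n ab ba.
rewrite ltr_pdivrMl// ab /=.
by move: ba; rewrite ltr_pdivrMl.
Qed.

End DivergenceFromCutPoint.

Theorem lemma3p15 (R : realType) (X : metricType R) (omega : set_system nat)
    (omegaU : UltraFilter omega) (o : nat -> X) (d : nat -> R)
    (d_gt0 : forall n, 0 < d n) :
  geodesic_space X -> nonprincipal omega -> d @ omega --> +oo ->
  ((exists C : Con omegaU o d_gt0, cut_point C) <->
   (exists a b c : nat -> X, superlinear_divergence omega o d a b c)) /\
  (forall a b c : nat -> X, superlinear_divergence omega o d a b c ->
   exists (ha : in_cone omega o d a) (hb : in_cone omega o d b)
          (hc : in_cone omega o d c),
     let A := cone_class omegaU d_gt0 ha in
     let B := cone_class omegaU d_gt0 hb in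
     let C := cone_class omegaU d_gt0 hc in
     cut_point C /\ separates C A B).
Proof.
move=> Xgeo _ dy.
have moreover (a b c : nat -> X) : superlinear_divergence omega o d a b c ->
    exists (ha : in_cone omega o d a) (hb : in_cone omega o d b)
           (hc : in_cone omega o d c),
      let A := cone_class omegaU d_gt0 ha in
      let B := cone_class omegaU d_gt0 hb in
      let C := cone_class omegaU d_gt0 hc in
      cut_point C /\ separates C A B.
  move=> /(superlinear_separates omegaU d_gt0 Xgeo)[ha [hb [hc sep]]].
  (* A connected complement of C would be the component of A, and B lies in it. *)
  exists ha, hb, hc; split=> // conn; have [AC BC] := sep; apply.
  by rewrite connected_component_id.
split=> //; split; first by move=> [C]; exact: cut_point_superlinear.
move=> [a [b [c /moreover[ha [hb [hc [cut _]]]]]]].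
by exists (cone_class omegaU d_gt0 hc).
Qed.
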